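(* Let $A$ be an integral domain and $E$ an $A$-module. If $E$ is a quasi second $A$-module, then for every $a\in A$ with $0\neq aE\neq E$, $aE$ is a second submodule of $E$. In particular, the converse holds if $\operatorname{ann}(E)$ is a semiprime ideal of $A$: if $\operatorname{ann}(E)$ is semiprime and $aE$ is a second submodule of $E$ for every $a\in A$ with $0\neq aE\neq E$, then $E$ is a quasi second $A$-module.
   Context: $\operatorname{ann}(E)=\{a\in A: aE=0\}$. $E$ is a quasi second module if for all $a,b\in A$, $0\neq bE\subseteq aE\neq E$ implies $bE=aE$. A nonzero submodule $L$ of $E$ is second if for every $x\in A$ either $xL=L$ or $xL=0$. A proper ideal $I$ of $A$ is semiprime if $a^n\in I$ ($a\in A$, $n\ge 1$) implies $a\in I$. *)

(* Defs.v *)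
From HB Require Import structures.
From mathcomp Require Import all_boot all_order all_algebra.
From mathcomp Require Import boolp classical_sets.

Set Implicit Arguments.
Unset Strict Implicit.
Unset Printing Implicit Defensive.

Import GRing.Theory.

Local Open Scope ring_scope.
Local Open Scope classical_set_scope.

Definition smul_set (A : comNzRingType) (E : lmodType A) (a : A) (L : set E) :
  set E := [set a *: v | v in L].

Definition smul_mod (A : comNzRingType) (E : lmodType A) (a : A) : set E :=
  smul_set a [set: E].

Arguments smul_mod {A} E a.

Definition ann (A : comNzRingType) (E : lmodType A) : set A :=
  [set a | smul_mod E a = [set 0]].

Arguments ann {A} E.

Definition quasi_second (A : comNzRingType) (E : lmodType A) : Prop :=
  forall a b : A,
    smul_mod E b <> [set 0] ->
    smul_mod E b `<=` smul_mod E a ->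
    smul_mod E a <> [set: E] ->
    smul_mod E b = smul_mod E a.

Definition second_submodule (A : comNzRingType) (E : lmodType A) (L : set E) :
  Prop :=
  [/\ GRing.submod_closed (mem L),
      L <> [set 0] &
      forall x : A, smul_set x L = L \/ smul_set x L = [set 0]].

(* [idealr_closed] includes properness, in the form [1 \notin I]. *)
Definition semiprime_ideal (A : comNzRingType) (I : set A) : Prop :=
  idealr_closed (mem I) /\
  (forall (a : A) (n : nat), (1 <= n)%N -> I (a ^+ n) -> I a).

(* Main.v *)
Require Import Defs.
From HB Require Import structures.
From mathcomp Require Import all_boot all_order all_algebra.
From mathcomp Require Import boolp classical_sets.

(** The two halves both compare the nested submodules [xaE = x(aE)] and [aE].

    If [E] is quasi second and [0 <> aE <> E], then for every [x] either
    [xaE = 0], or [xaE] is a nonzero submodule of the form [bE] inside [aE], and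
    quasi secondness forces [xaE = aE]; so [aE] is second.

    Conversely, let [0 <> bE] be contained in [aE <> E]. Then [aE] is nonzero,
    hence second, so [b(aE)] is [0] or [aE]. It cannot be [0], since
    [b^2 E = b(bE)] lies in [b(aE)] and semiprimeness would turn [b^2 E = 0]
    into [bE = 0]. Hence [aE = b(aE)], and commutativity of [A] puts [b(aE)]
    inside [bE]. *)

Set Implicit Arguments.
Unset Strict Implicit.
Unset Printing Implicit Defensive.

Import GRing.Theory.

Local Open Scope ring_scope.
Local Open Scope classical_set_scope.

Lemma smul_mod_closed (A : comNzRingType) (E : lmodType A) (a : A) :
  GRing.submod_closed (mem (smul_mod E a)).
Proof.
split; first by apply/mem_set; exists 0; rewrite ?scaler0.
move=> c u v /set_mem [u' _ <-] /set_mem [v' _ <-]; apply/mem_set.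
by exists (c *: u' + v') => //; rewrite scalerDr !scalerA mulrC.
Qed.

Lemma smul_set_mod (A : comNzRingType) (E : lmodType A) (x a : A) :
  smul_set x (smul_mod E a) = smul_mod E (x * a).
Proof.
apply/seteqP; split=> [_ [_ [u _ <-] <-]|_ [u _ <-]].
  by exists u; rewrite ?scalerA.
by exists (a *: u); [exists u | rewrite scalerA].
Qed.

Lemma smul_modM_subr (A : comNzRingType) (E : lmodType A) (x a : A) :
  smul_mod E (x * a) `<=` smul_mod E a.
Proof. by move=> _ [u _ <-]; exists (x *: u); rewrite // scalerA mulrC. Qed.

Lemma ann_sub (A : comNzRingType) (E : lmodType A) (a b : A) :
  smul_mod E b `<=` smul_mod E a -> ann E a -> ann E b.
Proof.
move=> ba a0; apply/seteqP; split=> [v /ba|_ ->]; first by rewrite a0.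
by exists 0; rewrite ?scaler0.
Qed.

Lemma quasi_second_smul_mod (A : comNzRingType) (E : lmodType A) (a : A) :
  quasi_second E -> smul_mod E a <> [set 0] -> smul_mod E a <> [set: E] ->
  second_submodule (smul_mod E a).
Proof.
move=> qsE a0 aT; split=> // [|x]; first exact: smul_mod_closed.
rewrite smul_set_mod; have [|xa0] := pselect (smul_mod E (x * a) = [set 0]).
  by right.
by left; apply: qsE => //; apply: smul_modM_subr.
Qed.

(** Secondness of [aE] offers [b(aE) = aE] or [b(aE) = 0]; the hypothesis on
    squares excludes the latter when [0 <> bE] lies in [aE]. *)
Lemma second_smul_mod_quasi_second (A : comNzRingType) (E : lmodType A) :
  (forall b : A, ann E (b ^+ 2) -> ann E b) ->
  (forall a : A, smul_mod E a <> [set 0] -> smul_mod E a <> [set: E] ->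
     second_submodule (smul_mod E a)) ->
  quasi_second E.
Proof.
move=> sqrt_ann secE a b b0 ba aT.
have a0 : smul_mod E a <> [set 0] by move=> /(ann_sub ba).
have [_ _ /(_ b)] := secE a a0 aT; rewrite smul_set_mod => -[baE|ba0].
  by apply/seteqP; split=> //; rewrite -baE mulrC; apply: smul_modM_subr.
(* [b(aE) = 0] is impossible, as it contains [b^2 E = b(bE)] *)
case: b0; apply: sqrt_ann; apply: ann_sub ba0.
rewrite expr2 -!smul_set_mod; exact: image_subset.
Qed.

Theorem proposition7 (A : idomainType) (E : lmodType A) :
  (quasi_second E ->
   forall a : A, smul_mod E a <> [set 0] -> smul_mod E a <> [set: E] ->
     second_submodule (smul_mod E a)) /\
  (semiprime_ideal (ann E) ->
   (forall a : A, smul_mod E a <> [set 0] -> smul_mod E a <> [set: E] ->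
      second_submodule (smul_mod E a)) ->
   quasi_second E).
Proof.
split=> [qsE a|[_ spE]]; first exact: quasi_second_smul_mod.
by apply: second_smul_mod_quasi_second => b; apply: spE.
Qed.
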